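(* Let $0=x_1<\dots<x_N=1$ be a partition of $I=[0,1]$, let $\{q_n\}$ be a sequence in $(0,1]$ with $\lim q_n=1$, and let $\alpha_i$, $i\in\mathbb{N}_{N-1}$, be bounded functions on $I$ with $\|\alpha_i\|_\infty<1$. Let $\{\lambda_i\}_{i\ge1}$ be a sequence of distinct positive real numbers with $\sum_{i=1}^\infty\frac{\lambda_i}{\lambda_i^2+1}=\infty$. Then the set \[ S=\bigcup_{n=1}^\infty\bigcup_{m=1}^\infty\operatorname{span}\{1,(x^{\lambda_1})^{(q_n,\alpha)}_n,\dots,(x^{\lambda_m})^{(q_n,\alpha)}_n\} \] is dense in $C[0,1]$ with respect to the sup-norm (i.e. every $f\in C[0,1]$ is a uniform limit of elements of $S$).
   Context: For $q\in(0,1]$: $[k]_q=\frac{1-q^k}{1-q}$ ($q\ne1$), $[k]_1=k$, $q$-factorials, $\binom{n}{k}_q=\frac{[n]_q!}{[k]_q![n-k]_q!}$. On $[0,1]$ the quantum MKZ operator is $M_{n,q}h(x)=\prod_{j=0}^n(1-q^jx)\sum_{k\ge0}\binom{n+k}{k}_q x^k h\!\left(\frac{[k]_q}{[k+n]_q}\right)$ for $0\le x<1$, $M_{n,q}h(1)=h(1)$. Let $u_i(x)=a_ix+b_i$ be the affine maps with $u_i(0)=x_i$, $u_i(1)=x_{i+1}$, $i\in\mathbb{N}_{N-1}$. For $h\in C[0,1]$, $h^{(q,\alpha)}_n$ denotes the unique bounded function $G:[0,1]\to\mathbb{R}$ with $G(u_i(x))=h(u_i(x))+\alpha_i(x)(G(x)-M_{n,q}h(x))$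 for all $x\in I$, $i\in\mathbb{N}_{N-1}$; $(x^{\lambda})^{(q,\alpha)}_n$ is this function for $h(x)=x^\lambda$. *)

(* Defs.v *)
From HB Require Import structures.
From mathcomp Require Import all_boot all_order all_algebra.
From mathcomp Require Import all_classical all_reals all_analysis.
Set Implicit Arguments. Unset Strict Implicit. Unset Printing Implicit Defensive.
Import Order.TTheory GRing.Theory Num.Theory.
Import numFieldNormedType.Exports.
Local Open Scope classical_set_scope.
Local Open Scope ring_scope.

Section QDefs.
Variable R : realType.

Definition qint (q : R) (k : nat) : R :=
  if q == 1 then k%:R else (1 - q ^+ k) / (1 - q).

Definition qfact (q : R) (k : nat) : R := \prod_(1 <= j < k.+1) qint q j.

Definition qbinom (q : R) (n k : nat) : R :=
  qfact q n / (qfact q k * qfact q (n - k)).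

Definition MKZ (n : nat) (q : R) (h : R -> R) (x : R) : R :=
  if x == 1 then h 1 else
  (\prod_(j < n.+1) (1 - q ^+ j * x)) *
  limn (fun K => \sum_(0 <= k < K)
          (qbinom q (n + k) k * x ^+ k * h (qint q k / qint q (k + n)))).

Definition uaff (xs : nat -> R) (i : nat) (t : R) : R :=
  (xs i.+1 - xs i) * t + xs i.

Definition is_fractal (N : nat) (xs : nat -> R) (alpha : nat -> R -> R)
    (n : nat) (q : R) (h G : R -> R) : Prop :=
  (exists C : R, forall t, 0 <= t <= 1 -> `|G t| <= C) /\
  forall i t, (1 <= i <= N.-1)%N -> 0 <= t <= 1 ->
    G (uaff xs i t) = h (uaff xs i t) + alpha i t * (G t - MKZ n q h t).

(* h^{(q,alpha)}_n : the (unique, by the paper) bounded solution *)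
Definition fractal (N : nat) (xs : nat -> R) (alpha : nat -> R -> R)
    (n : nat) (q : R) (h : R -> R) : R -> R :=
  xget (fun _ => 0) [set G | is_fractal N xs alpha n q h G].

End QDefs.

(* Main.v *)
(** Two ingredients: the full Müntz theorem, and [‖h^(q,α)_n - h‖ -> 0] for each
    fixed continuous [h].

    Müntz: put [x = e^(-s)].  Convolution with [e^(-l s)] turns the exponential
    [e^(-p s)] into a multiple of [e^(-p s) - e^(-l s)], and
    [F |-> F - 2 l (F * e^(-l s))] is an isometry of [L^2(ds)] which multiplies
    [e^(-p s)] by [(p + l) / (p - l)] modulo [e^(-l s)].  Applying it for
    [l = λ_2, ..., λ_m] shows that the [L^2(ds)] distance of [e^(-p s)] to the
    span of the [e^(-λ_i s)] is at most [∏ |p - λ_i| / (p + λ_i)], up to a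
    constant, and this tends to 0 by the divergence hypothesis.  One more
    convolution, with [e^(-λ_1 s)], maps [L^2] to [L^∞] and stays in the span, so
    the approximation becomes uniform.

    Fractal functions: the functional equation is a contraction with constant
    [a = max ‖α_i‖ < 1], so [‖G - h‖ <= ‖h - M h‖ / (1 - a)], and a second moment
    estimate bounds [‖h - M_(n,q) h‖] in terms of [1 / [n]_q]. *)
Require Import Defs.
From HB Require Import structures.
From mathcomp Require Import all_boot all_order all_algebra.
From mathcomp Require Import all_classical all_reals all_analysis.
From mathcomp Require Import ring lra.
Import Order.TTheory GRing.Theory Num.Theory.
Import numFieldNormedType.Exports.
Local Open Scope classical_set_scope.
Local Open Scope ring_scope.

(** * Uniform approximation by exponentials *)

Definition expsum {R : realType} (n : nat) (a nu : nat -> R) (s : R) : R :=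
  \sum_(i < n) a i * expR (- nu i * s).

(* The convolution of [expsum n a nu] with [e^(-l s)] on [[0, s]], in closed form;
   meaningful only when [l] is none of the [nu i]. *)
Definition expconv {R : realType} (n : nat) (a nu : nat -> R) (l s : R) : R :=
  \sum_(i < n) a i / (l - nu i) * (expR (- nu i * s) - expR (- l * s)).

Lemma is_derive_expRM {R : realType} (l s : R) :
  is_derive s 1 (fun s => expR (- l * s)) (- l * expR (- l * s)).
Proof.
have d : is_derive s 1 (fun s : R => - l * s) (- l).
  apply: is_derive_eq; rewrite /GRing.scale/= mulr1; ring.
have := @is_derive1_comp R expR (fun s => - l * s) s _ _ _ d.
by move=> H; apply: is_derive_eq; rewrite mulrC.
Qed.

(** The linear equation [G' = F - l G] carries everything used about the convolution, so the [L^2]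
    argument runs on derivatives alone. *)
Lemma is_derive_expconv {R : realType} n (a nu : nat -> R) (l s : R) :
  (forall i, (i < n)%N -> nu i != l) ->
  is_derive s 1 (expconv n a nu l) (expsum n a nu s - l * expconv n a nu l s).
Proof.
move=> nul.
have D (i : 'I_n) : is_derive s 1
    (fun s => a i / (l - nu i) * (expR (- nu i * s) - expR (- l * s)))
    (a i * expR (- nu i * s) -
     l * (a i / (l - nu i) * (expR (- nu i * s) - expR (- l * s)))).
  have d1 := is_derive_expRM (nu i) s; have d2 := is_derive_expRM l s.
  have := @is_deriveZ R _ _ _ (a i / (l - nu i)) _ _ _ (is_deriveB d1 d2).
  move=> d; apply: is_derive_eq.
  have : l - nu i != 0 by rewrite subr_eq0 eq_sym nul.
  by rewrite /GRing.scale/= => ?; field.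
have := @is_derive_sum R _ _ n _ s 1 _ D.
rewrite /expconv /expsum mulr_sumr -sumrB fct_sumE.
by [].
Qed.

Lemma is_derive_nondecreasing {R : realType} (f df : R -> R) :
  (forall s : R, is_derive s (1 : R) f (df s)) -> (forall s, 0 <= df s) ->
  {homo f : x y / x <= y}.
Proof.
move=> fd df0 x y xy.
apply: (@ger0_derive1_ndecry R f x) => // [z _|].
- by rewrite derive1E derive_val.
- apply: continuous_subspaceT => z.
  by apply/differentiable_continuous/derivable1_diffP.
Qed.

(* In the variable [s = - ln x], [F |-> F - 2 l (F * e^(-l s))] is the Blaschke
   factor of [l] and hence an isometry of [L^2(ds)]; [V] is the primitive of the
   squared function, and [V] loses only the boundary term [2 l (F * e^(-l s))^2]. *)
Lemma is_derive_blaschke {R : realType} n (a nu : nat -> R) (l s : R) V :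
  (forall i, (i < n)%N -> nu i != l) ->
  (is_derive s 1 V (expsum n a nu s ^+ 2)) ->
  is_derive s 1 (fun s => V s - 2 * l * expconv n a nu l s ^+ 2)
   ((expsum n a nu s - 2 * l * expconv n a nu l s) ^+ 2).
Proof.
move=> nul dV; have dG := @is_derive_expconv R n a nu l s nul.
have := is_deriveB dV (@is_deriveZ R _ _ _ (2 * l) _ _ _ (@is_deriveX R _ _ 1 _ _ _ dG)).
move=> d; apply: is_derive_eq.
by rewrite /GRing.scale/=; ring.
Qed.

Lemma expconv0 {R : realType} n (a nu : nat -> R) (l : R) :
  expconv n a nu l 0 = 0.
Proof. by rewrite /expconv big1// => i _; rewrite !mulr0 subrr mulr0. Qed.

(** Induction on [m]: the Blaschke factor of [nu m.+1] multiplies the leading coefficient by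
    [(nu 0 + l) / (nu 0 - l)] and subtracts a nonnegative boundary term from [V], so the initial
    bound on [V] survives. *)
Lemma blaschke_expsum {R : realType} (nu : nat -> R) (m : nat) :
  (forall i, 0 < nu i) -> injective nu ->
  exists (a : nat -> R) (V : R -> R),
    [/\ a 0%N = \prod_(1 <= i < m.+1) ((nu 0%N + nu i) / (nu 0%N - nu i)),
        forall s : R, is_derive s (1 : R) V (expsum m.+1 a nu s ^+ 2),
        V 0 = 0 & forall s : R, 0 <= s -> V s <= (2 * nu 0%N)^-1].
Proof.
move=> nu0 nuI; have n0 := nu0 0%N; elim: m => [|m [a [V [a0 dV V0 Vle]]]].
  exists (fun=> 1), (fun s => (2 * nu 0%N)^-1 * (1 - expR (- (2 * nu 0%N) * s))).
  split; first by rewrite big_nil.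
  - move=> s; have d := is_derive_expRM (2 * nu 0%N) s.
    have := @is_deriveZ R _ _ _ ((2 * nu 0%N)^-1) _ _ _
      (is_deriveB (is_derive_cst (1 : R) s 1) d).
    move=> d'; apply: is_derive_eq.
    rewrite /GRing.scale/= /expsum big_ord1 mul1r expr2 -expRD.
    have -> : - nu 0%N * s + - nu 0%N * s = - (2 * nu 0%N) * s by ring.
    by rewrite sub0r; field; rewrite gt_eqF.
  - by rewrite mulr0 expR0 subrr mulr0.
  - move=> s s0; rewrite -[leRHS]mulr1 ler_pM2l ?invr_gt0 ?mulr_gt0//.
set l := nu m.+1.
have nul i : (i < m.+1)%N -> nu i != l.
  by move=> im; apply/eqP => /nuI eim; rewrite eim ltnn in im.
pose G := expconv m.+1 a nu l.
(* Coefficients of [F - 2 l G]: an old exponential is scaled by [1 - 2 l / (l - nu i)], and all the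
   [e^(-l s)] parts of [G] collect in the last coefficient. *)
pose b i := if (i < m.+1)%N then a i * ((nu i + l) / (nu i - l))
            else 2 * l * \sum_(i < m.+1) a i / (l - nu i).
have bE s : expsum m.+2 b nu s = expsum m.+1 a nu s - 2 * l * G s.
  rewrite /expsum big_ord_recr/= /b ltnn mulr_sumr mulr_suml -big_split/=.
  rewrite /G /expconv mulr_sumr -sumrB; apply: eq_bigr => i _.
  rewrite ltn_ord -/l; field.
  by rewrite !subr_eq0 nul//= eq_sym nul.
exists b, (fun s => V s - 2 * l * G s ^+ 2); split.
- by rewrite big_nat_recr//= -a0 /b.
- by move=> s; rewrite bE; apply: is_derive_blaschke.
- by rewrite /G expconv0 V0 expr0n/= mulr0 subrr.
- move=> s s0; apply: le_trans (Vle s s0).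
  by rewrite lerBlDr lerDl mulr_ge0 ?sqr_ge0// mulr_ge0// ltW// nu0.
Qed.

(** The error is a multiple [r G] of the convolution of the Blaschke-transformed sum with
    [e^(-l s)]. The factor [1 / a 0] in [r] produces the product, and [G] has a bound independent of
    [m]. *)
Lemma expR_approx {R : realType} (nu : nat -> R) (l : R) (m : nat) :
  (forall i, 0 < nu i) -> injective nu -> 0 < l -> (forall i, nu i != l) ->
  exists (b : nat -> R) (b' : R), forall s : R, 0 <= s ->
    `|expR (- nu 0%N * s) -
      (b' * expR (- l * s) + \sum_(1 <= i < m.+1) b i * expR (- nu i * s))| <=
    `|l - nu 0%N| / (2 * Num.sqrt (l * nu 0%N)) *
    \prod_(1 <= i < m.+1) `|(nu 0%N - nu i) / (nu 0%N + nu i)|.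
Proof.
move=> nu0 nuI l0 nul; have n0 := nu0 0%N.
have [a [V [a0 dV V0 Vle]]] := @blaschke_expsum R nu m nu0 nuI.
pose G := expconv m.+1 a nu l.
have an0  : a 0%N != 0.
  rewrite a0 prodf_seq_neq0; apply/allP => i /=; rewrite mem_index_iota => /andP[i1 _].
  apply: mulf_neq0; first by rewrite lt0r_neq0// addr_gt0.
  rewrite invr_eq0 subr_eq0.
  by apply/eqP => /nuI i0; rewrite -i0 in i1.
(* [V - 2 l G^2] has a square as derivative and vanishes at 0, hence
   [2 l G^2 <= V <= 1 / (2 nu 0)]. *)
have G2 s : 0 <= s -> G s ^+ 2 <= (4 * (l * nu 0%N))^-1.
  move=> s0.
  have := @is_derive_nondecreasing R _ _ (fun s => @is_derive_blaschke R
     m.+1 a nu l s V (fun i _ => nul i) (dV s)) (fun s => sqr_ge0 _) 0 s s0.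
  rewrite expconv0 V0 expr0n/= mulr0 subrr subr_ge0 -/(G s) => H.
  have {H}H := le_trans H (Vle s s0).
  rewrite -(ler_pM2l (_ : 0 < 2 * l)) ?mulr_gt0//; apply: le_trans H _.
  by rewrite le_eqVlt; apply/orP; left; apply/eqP; field; rewrite !gt_eqF.
have Gs s : 0 <= s -> `|G s| <= (2 * Num.sqrt (l * nu 0%N))^-1.
  move=> s0; have r0 : 0 <= (2 * Num.sqrt (l * nu 0%N))^-1.
    by rewrite invr_ge0 mulr_ge0// sqrtr_ge0.
  rewrite -(ler_pXn2r (_ : 0 < 2)%N)// ?nnegrE// real_normK ?num_real//.
  rewrite exprVn exprMn sqr_sqrtr; last by rewrite mulr_ge0// ltW.
  by rewrite -natrX; exact: G2.
(* This normalises the coefficient of [e^(-nu 0 s)] in [r G] to 1. *)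
pose r := (l - nu 0%N) / a 0%N.
exists (fun i => - (r * (a i / (l - nu i)))),
  (r * \sum_(i < m.+1) a i / (l - nu i)) => s s0.
have -> : expR (- nu 0%N * s) - (r * (\sum_(i < m.+1) a i / (l - nu i)) *
    expR (- l * s) + \sum_(1 <= i < m.+1)
      - (r * (a i / (l - nu i))) * expR (- nu i * s)) = r * G s.
  rewrite /G /expconv.
  under [in RHS]eq_bigr do rewrite mulrBr.
  rewrite sumrB -mulr_suml mulrBr [in RHS]big_ord_recl/=.
  rewrite -(big_mkord xpredT (fun i => a i.+1 / (l - nu i.+1) * expR (- nu i.+1 * s))).
  rewrite -(big_add1 _ _ 0%N m.+1 xpredT (fun i => a i / (l - nu i) * expR (- nu i * s))).
  under [X in _ - (_ + X)]eq_bigr do rewrite mulNr -mulrA.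
  rewrite sumrN -mulr_sumr [in RHS]mulrDr.
  have -> : r * (a 0%N / (l - nu 0%N) * expR (- nu 0%N * s)) = expR (- nu 0%N * s).
    by rewrite /r; field; rewrite an0 subr_eq0 eq_sym nul.
  ring.
have -> : \prod_(1 <= i < m.+1) `|(nu 0%N - nu i) / (nu 0%N + nu i)| = `|(a 0%N)^-1|.
  by rewrite a0 -prodfV normr_prod; apply: eq_bigr => i _; rewrite invf_div.
by rewrite normrM /r normrM mulrAC ler_wpM2r// ler_wpM2l// Gs.
Qed.

(** * The full Müntz theorem *)

(** After clearing denominators this is [(p - u)^2 <= (p^2 + 1) (u^2 + 1)], because
    [(p + u)^2 - (p - u)^2 = 4 p u]. *)
Lemma blaschke_factor_le {R : realType} (p u : R) : 0 < p -> 0 < u ->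
  ((p - u) / (p + u)) ^+ 2 * (1 + 4 * p / (p ^+ 2 + 1) * (u / (u ^+ 2 + 1))) <= 1.
Proof.
move=> p0 u0.
have pu : 0 < (p + u) ^+ 2 by rewrite exprn_gt0// addr_gt0.
have p1 : 0 < p ^+ 2 + 1 by rewrite ltr_wpDl ?sqr_ge0.
have u1 : 0 < u ^+ 2 + 1 by rewrite ltr_wpDl ?sqr_ge0.
rewrite exprMn exprVn mulrAC ler_pdivrMr// mul1r.
have -> : 1 + 4 * p / (p ^+ 2 + 1) * (u / (u ^+ 2 + 1)) =
  ((p ^+ 2 + 1) * (u ^+ 2 + 1) + 4 * (p * u)) / ((p ^+ 2 + 1) * (u ^+ 2 + 1)).
  by field; rewrite !lt0r_neq0.
rewrite [leLHS]mulrA ler_pdivrMr ?mulr_gt0//.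
have pu4 : 0 < 4 * (p * u) by rewrite !mulr_gt0.
set A := (p ^+ 2 + 1) * (u ^+ 2 + 1).
suff : (p - u) ^+ 2 * (4 * (p * u)) <= ((p + u) ^+ 2 - (p - u) ^+ 2) * A by lra.
have -> : (p + u) ^+ 2 - (p - u) ^+ 2 = 4 * (p * u) by ring.
rewrite mulrC ler_pM2l// /A; nra.
Qed.

(** The squared product times [1 + k S m] stays at most 1, where [S m] is the divergent partial sum;
    the induction uses [1 + k (S + t) <= (1 + k t) (1 + k S)]. *)
Lemma blaschke_prod_small {R : realType} (p : R) (mu : nat -> R) :
  0 < p -> (forall i, 0 < mu i) ->
  (fun m => \sum_(1 <= i < m.+1) mu i / (mu i ^+ 2 + 1)) @ \oo --> +oo ->
  forall e : R, 0 < e -> exists m : nat,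
    \prod_(1 <= i < m.+1) `|(p - mu i) / (p + mu i)| < e.
Proof.
move=> p0 mu0 div e e0.
pose k := 4 * p / (p ^+ 2 + 1).
have k0 : 0 < k by rewrite !mulr_gt0// invr_gt0 ltr_wpDl ?sqr_ge0.
pose S m := \sum_(1 <= i < m.+1) mu i / (mu i ^+ 2 + 1).
pose P m := \prod_(1 <= i < m.+1) `|(p - mu i) / (p + mu i)|.
have t0 i : 0 <= mu i / (mu i ^+ 2 + 1).
  by rewrite divr_ge0 ?ltW// ltr_wpDl ?sqr_ge0.
have S0 m : 0 <= S m by rewrite /S sumr_ge0.
have P0 m : 0 <= P m by rewrite /P prodr_ge0.
have PS m : P m ^+ 2 * (1 + k * S m) <= 1.
  elim: m => [|m IH]; first by rewrite /P /S !big_geq// mulr0 addr0 mulr1 expr1n.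
  apply: le_trans IH; rewrite /P /S big_nat_recr// [X in 1 + k * X]big_nat_recr//=.
  rewrite -/(P m) -/(S m) exprMn -mulrA ler_wpM2l ?sqr_ge0//.
  rewrite real_normK ?num_real//.
  have := blaschke_factor_le p (mu m.+1) p0 (mu0 _); rewrite -/k.
  move: (t0 m.+1); set t := _ / (_ + 1); set b := _ ^+ 2 => t0' bt.
  have b0 : 0 <= b by exact: sqr_ge0.
  apply: (@le_trans _ _ (b * (1 + k * t) * (1 + k * S m))); last first.
    by rewrite ler_piMl// addr_ge0// mulr_ge0// ltW.
  rewrite -mulrA ler_wpM2l//.
  by have := mulr_ge0 (mulr_ge0 (ltW k0) t0') (mulr_ge0 (ltW k0) (S0 m)); lra.
have [m Sm] : exists m, (e ^+ 2 * k)^-1 <= S m.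
  move/cvgryPge : div => /(_ (e ^+ 2 * k)^-1) [m _ /(_ m)/= H].
  by exists m; exact: H.
exists m; rewrite -/(P m) -(ltr_pXn2r (_ : 0 < 2)%N)// ?nnegrE// ?ltW//.
rewrite -(ltr_pM2r (_ : 0 < 1 + k * S m)); last first.
  by rewrite ltr_wpDr// mulr_ge0// ltW.
apply: le_lt_trans (PS m) _; rewrite mulrDr mulr1.
apply: ltr_pwDl; first by rewrite exprn_gt0.
by rewrite mulrA -ler_pdivrMl ?mulr1// mulr_gt0 ?exprn_gt0.
Qed.

(** * The sup-norm closure of a span, as a closed linear subspace *)

Definition span_dense {R : realType} (e : nat -> R -> R) (f : R -> R) :=
  forall eps : R, 0 < eps -> exists (m : nat) (c : nat -> R), forall x, 0 <= x <= 1 ->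
    `|f x - \sum_(i < m) c i * e i x| <= eps.

Lemma sum_widen {R : realType} (e : nat -> R -> R) (c : nat -> R) m M x :
  (m <= M)%N -> \sum_(i < m) c i * e i x =
    \sum_(i < M) (if (i < m)%N then c i else 0) * e i x.
Proof.
move=> mM; rewrite (big_ord_widen M (fun i => c i * e i x) mM) big_mkcond/=.
by apply: eq_bigr => i _; case: ifP => // _; rewrite mul0r.
Qed.

Lemma span_dense_member {R : realType} (e : nat -> R -> R) i : span_dense e (e i).
Proof.
move=> eps e0; exists i.+1, (fun j => (j == i)%:R) => x _.
rewrite big_ord_recr/= eqxx mul1r big1 ?add0r ?subrr ?normr0 ?ltW// => j _.
by rewrite ltn_eqF ?mul0r.
Qed.

Lemma span_denseD {R : realType} (e : nat -> R -> R) f g :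
  span_dense e f -> span_dense e g -> span_dense e (fun x => f x + g x).
Proof.
move=> df dg eps e0; have e20 : 0 < eps / 2 by rewrite divr_gt0.
have [m1 [c1 H1]] := df _ e20; have [m2 [c2 H2]] := dg _ e20.
exists (maxn m1 m2), (fun i => (if (i < m1)%N then c1 i else 0) +
  (if (i < m2)%N then c2 i else 0)) => x x01.
under eq_bigr do rewrite mulrDl.
rewrite big_split/= -!sum_widen ?leq_maxl ?leq_maxr//.
by rewrite opprD addrACA (splitr eps) (le_trans (ler_normD _ _))// lerD ?H1 ?H2.
Qed.

Lemma span_denseZ {R : realType} (e : nat -> R -> R) (a : R) f :
  span_dense e f -> span_dense e (fun x => a * f x).
Proof.
move=> df eps e0; have e20 : 0 < eps / (`|a| + 1).
  by rewrite divr_gt0// ltr_wpDl.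
have [m [c H]] := df _ e20.
exists m, (fun i => a * c i) => x x01.
under eq_bigr do rewrite -mulrA.
rewrite -mulr_sumr -mulrBr normrM.
apply: (@le_trans _ _ ((`|a| + 1) * (eps / (`|a| + 1)))).
  by apply: ler_pM => //; [rewrite lerDl | exact: H].
by rewrite mulrCA divff ?mulr1// lt0r_neq0// ltr_wpDl.
Qed.

Lemma span_dense_eq {R : realType} (e : nat -> R -> R) f g :
  (forall x, 0 <= x <= 1 -> f x = g x) -> span_dense e f -> span_dense e g.
Proof.
move=> fg df eps e0; have [m [c H]] := df _ e0.
by exists m, c => x x01; rewrite -fg// H.
Qed.

Lemma span_dense_lim {R : realType} (e : nat -> R -> R) f :
  (forall eps : R, 0 < eps -> exists2 g, span_dense e g &
     forall x, 0 <= x <= 1 -> `|f x - g x| <= eps) -> span_dense e f.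
Proof.
move=> H eps e0; have e20 : 0 < eps / 2 by rewrite divr_gt0.
have [g dg fg] := H _ e20; have [m [c gc]] := dg _ e20.
exists m, c => x x01; rewrite (splitr eps).
by rewrite (le_trans (ler_distD (g x) _ _))// lerD ?fg ?gc.
Qed.

Definition muntz_fam {R : realType} (lam : nat -> R) (i : nat) (x : R) : R :=
  if i is 0 then 1 else x `^ lam i.

(** If [p] is not one of the exponents, [lam 1] is reserved for the final convolution and the others
    serve as Blaschke factors; removing one term does not affect divergence. *)
Lemma span_dense_powR {R : realType} (lam : nat -> R) (p : R) : 0 < p ->
  (forall i, (1 <= i)%N -> 0 < lam i) ->
  (forall i j, (1 <= i)%N -> (1 <= j)%N -> lam i = lam j -> i = j) ->
  (fun m => \sum_(1 <= i < m.+1) lam i / (lam i ^+ 2 + 1)) @ \oo --> +oo ->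
  span_dense (muntz_fam lam) (fun x => x `^ p).
Proof.
move=> p0 lam0 lamI div.
have [[i i1 ->]|np] := pselect (exists2 i, (1 <= i)%N & p = lam i).
  by case: i i1 => // i _; exact: (span_dense_member (muntz_fam lam) i.+1).
move=> eps e0.
pose nu i := if i is j.+1 then lam j.+2 else p.
have nu0 i : 0 < nu i by case: i => // i; apply: lam0.
have nuI : injective nu.
  case=> [|i] [|j] //= => [E|E|]; [by case: np; exists j.+2|by case: np; exists i.+2|].
  by move=> E; have [->] := lamI i.+2 j.+2 isT isT E.
have nul i : nu i != lam 1%N.
  case: i => [|i] /=; apply/eqP; first by move=> E; apply: np; exists 1%N.
  by move=> E; have := lamI i.+2 1%N isT isT E.
have l0 := lam0 1%N isT.
pose K := `|lam 1%N - p| / (2 * Num.sqrt (lam 1%N * p)).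
have K0 : 0 <= K by rewrite divr_ge0// mulr_ge0// sqrtr_ge0.
have div' : (fun m => \sum_(1 <= i < m.+1) nu i / (nu i ^+ 2 + 1)) @ \oo --> +oo.
  apply/cvgryPge => A.
  move/cvgryPge : div => /(_ (A + lam 1%N / (lam 1%N ^+ 2 + 1))) [M _ H].
  exists M => // m /= Mm; have := H m.+1 (leqW Mm).
  rewrite /= big_ltn// big_add1/= addrC lerD2l => /le_trans; apply.
  by rewrite big_add1/= [leRHS]big_add1.
have [m Pm] := blaschke_prod_small p nu p0 nu0 div' (eps / (K + 1)) (divr_gt0 e0 (ltr_wpDl K0 ltr01)).
have [b [b' H]] := expR_approx nu (lam 1%N) m nu0 nuI l0 nul.
exists m.+2, (fun i => match i with 0 => 0 | 1 => b' | i.+1 => b i end).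
(* At [x = 0] the substitution [s = - ln x] fails, but all powers vanish there and the constant
   function has coefficient 0. *)
move=> x /andP[]; rewrite le_eqVlt => /orP[/eqP<- _|x0 x1].
  rewrite powR0 ?lt0r_neq0// big1 ?subr0 ?normr0 ?ltW// => -[[|i] im] _ /=.
    by rewrite mul0r.
  by rewrite powR0 ?mulr0// lt0r_neq0// lam0.
have powE (l : R) : x `^ l = expR (- l * - ln x) by rewrite /powR gt_eqF// mulrNN.
have s0 : 0 <= - ln x by rewrite oppr_ge0 ln_le0.
have -> : x `^ p - \sum_(i < m.+2)
    match i : nat with 0 => 0 | 1 => b' | (_.+1 as j).+1 => b j end * muntz_fam lam i x =
  expR (- nu 0%N * - ln x) - (b' * expR (- lam 1%N * - ln x) +
   \sum_(1 <= i < m.+1) b i * expR (- nu i * - ln x)).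
  rewrite powE !big_ord_recl/= mul0r add0r powE; congr (_ - (_ + _)).
  rewrite big_add1/= big_mkord; apply: eq_bigr => i _.
  by rewrite /= powE.
apply: le_trans (H _ s0) _.
apply: (@le_trans _ _ ((K + 1) * (eps / (K + 1)))).
  by apply: ler_pM => //; [exact: prodr_ge0|rewrite lerDl|exact: ltW].
by rewrite mulrCA divff ?mulr1// lt0r_neq0// ltr_wpDl.
Qed.

(** * Uniform continuity and Bernstein approximation *)

Lemma within_continuous_unif {R : realType} (f : R -> R) (a b : R) :
  {within `[a, b], continuous f} -> forall eps : R, 0 < eps ->
  exists2 d : R, 0 < d & forall x y, a <= x <= b -> a <= y <= b ->
    `|x - y| < d -> `|f x - f y| < eps.
Proof.
move=> /subspace_continuousP cf eps e0.
have /compact_near_coveringP cpt := @segment_compact R a b.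
pose P (d x : R) := a <= x <= b -> forall y, a <= y <= b -> `|x - y| < d -> `|f x - f y| < eps.
have : \forall d \near 0^'+, `[a, b] `<=` P d.
  apply: (cpt R 0^'+ P) => x xab.
  have e20 : 0 < eps / 2 by rewrite divr_gt0.
  have /cvgrPdist_lt/(_ _ e20) := cf x xab.
  rewrite nearE /within/= => /nbhs_ballP[n /= n0 H].
  have n20 : 0 < n / 2 by rewrite divr_gt0.
  (* Half the continuity radius at [x]: a point within [n / 2] of some [x'] in this ball is within
     [n] of [x]. *)
  exists (ball x (n / 2), [set d | d < n / 2]) => /=.
    by split; [exact: nbhsx_ballx|exact: nbhs_right_lt].
  move=> [x' d] [/= xx' dn] x'ab y yab x'y.
  rewrite (splitr eps) (le_lt_trans (ler_distD (f x) _ _))// ltrD//.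
    rewrite distrC; apply: H; last by rewrite /= in_itv.
    by apply: le_ball xx'; rewrite ler_pdivrMr// ler_peMr ?ltW// ltr1n.
  apply: H; last by rewrite /= in_itv.
  rewrite /ball/= (splitr n) (le_lt_trans (ler_distD x' _ _))// ltrD//.
  exact: lt_trans dn.
move=> H; near (0 : R)^'+ => d.
exists d => // x y xab yab; apply: (near H d _) => //; rewrite /= ?in_itv//.
Unshelve. all: by end_near. Qed.

(* The form of uniform continuity that suits positive operators: it is enough to
   estimate their second moment. *)
Lemma within_continuous_quadratic {R : realType} (f : R -> R) :
  {within `[0, 1], continuous f} -> forall eps : R, 0 < eps ->
  exists2 C : R, 0 <= C & forall x y, 0 <= x <= 1 -> 0 <= y <= 1 ->
    `|f x - f y| <= eps + C * (x - y) ^+ 2.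
Proof.
move=> cf eps e0; have [d d0 H] := within_continuous_unif f 0 1 cf eps e0.
have [c1 _ M1] := EVT_max ler01 cf; have [c2 _ M2] := EVT_min ler01 cf.
have fb x y : 0 <= x <= 1 -> 0 <= y <= 1 -> `|f x - f y| <= `|f c1 - f c2|.
  move=> x01 y01; apply: le_trans (ler_norm _).
  have := M1 x; have := M1 y; have := M2 x; have := M2 y; rewrite !in_itv/=.
  do 4 (move=> /(_ _)/wrap[//|?]).
  by rewrite ler_norml; apply/andP; split; lra.
(* At distance at least [d] the quadratic term alone exceeds the total oscillation of [f]. *)
exists (`|f c1 - f c2| / d ^+ 2); first by rewrite divr_ge0// sqr_ge0.
move=> x y x01 y01; have [xyd|xyd] := ltP `|x - y| d.
  apply: ler_wpDr; last exact/ltW/H.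
  by rewrite mulr_ge0 ?divr_ge0 ?sqr_ge0.
apply: ler_wpDl; first exact: ltW.
apply: (le_trans (fb x y x01 y01)).
rewrite -mulrA ler_peMr// mulrC ler_pdivlMr ?exprn_gt0// mul1r.
by rewrite -(real_normK (num_real (x - y))) lerXn2r ?nnegrE// ltW.
Qed.

(* [bern n g x] is the expectation of [g] under the binomial law [B(n, x)], by
   conditioning on the first trial. *)
Fixpoint bern {R : realType} (n : nat) (g : nat -> R) (x : R) : R :=
  if n is n'.+1 then (1 - x) * bern n' g x + x * bern n' (g \o S) x else g 0%N.

Lemma bern_le {R : realType} n (g h : nat -> R) (x : R) : 0 <= x <= 1 ->
  (forall k, (k <= n)%N -> g k <= h k) -> bern n g x <= bern n h x.
Proof.
move=> /andP[x0 x1]; elim: n g h => [|n IH] g h gh /=; first exact: gh.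
apply: lerD; apply: ler_wpM2l; rewrite ?subr_ge0//; apply: IH => k kn.
  by apply: gh; exact: leqW.
exact: gh.
Qed.

(** Mean [n x] and variance [n x (1 - x)] of the binomial law. The centre [c] is arbitrary because a
    successful first trial shifts it to [c - 1]. *)
Lemma bern_quadratic {R : realType} n (x a b c : R) :
  bern n (fun k => a + b * (k%:R - c) ^+ 2) x =
  a + b * (n%:R * x * (1 - x) + (n%:R * x - c) ^+ 2).
Proof.
elim: n c => [|n IH] c /=; first by ring.
have -> : (fun k => a + b * (k%:R - c) ^+ 2) \o S =
    (fun k => a + b * (k%:R - (c - 1)) ^+ 2).
  by apply/funext => k /=; rewrite -natr1; ring.
by rewrite !IH -natr1; ring.
Qed.

(** The factor [x ^+ k] strengthens the induction, since each conditioning step multiplies by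
    [x]. *)
Lemma span_dense_bern {R : realType} (e : nat -> R -> R) n g k :
  (forall j, span_dense e (fun x => x ^+ j)) ->
  span_dense e (fun x => x ^+ k * bern n g x).
Proof.
move=> dX; elim: n g k => [|n IH] g k /=.
  by apply: span_dense_eq (span_denseZ e (g 0%N) _ (dX k)) => x _; rewrite mulrC.
apply: span_dense_eq (span_denseD e _ _ (span_denseD e _ _ (IH g k)
  (span_denseZ e (-1) _ (IH g k.+1))) (IH (g \o S) k.+1)) => x _.
by rewrite exprS; ring.
Qed.

(** Weierstrass by Bernstein polynomials: the quadratic modulus reduces the error to the binomial
    variance. *)
Lemma span_dense_continuous {R : realType} (e : nat -> R -> R) (f : R -> R) :
  (forall j, span_dense e (fun x => x ^+ j)) ->
  {within `[0, 1], continuous f} -> span_dense e f.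
Proof.
move=> dX cf; apply: span_dense_lim => eps e0.
have e20 : 0 < eps / 2 by rewrite divr_gt0.
have [C C0 H] := within_continuous_quadratic f cf _ e20.
(* Large enough that the variance term [C x (1 - x) / n] is at most [eps / 2]. *)
pose n := (Num.truncn (C / (eps / 2))).+1.
have nP : C / (eps / 2) < n%:R by exact: truncnS_gt.
have n0 : 0 < n%:R :> R by rewrite ltr0n.
pose g k : R := f (k%:R / n%:R).
exists (bern n g).
  by apply: span_dense_eq (span_dense_bern e n g 0 dX) => x _; rewrite expr0 mul1r.
move=> x x01.
have kn k : (k <= n)%N -> 0 <= (k%:R / n%:R : R) <= 1.
  by move=> kn; rewrite divr_ge0//= ler_pdivrMr// mul1r ler_nat.
have gE k : (k <= n)%N -> `|g k - f x| <= eps / 2 + C / n%:R ^+ 2 * (k%:R - n%:R * x) ^+ 2.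
  move=> /kn k01; apply: le_trans (H _ x k01 x01) _.
  rewrite lerD2l -mulrA ler_wpM2l// le_eqVlt; apply/orP; left; apply/eqP.
  by field; rewrite lt0r_neq0.
have xx : 0 <= x * (1 - x) <= 1.
  by move: x01 => /andP[x0 x1]; apply/andP; split; nra.
have B : C / n%:R ^+ 2 * (n%:R * x * (1 - x) + (n%:R * x - n%:R * x) ^+ 2) <= eps / 2.
  rewrite subrr expr0n/= addr0.
  have -> : C / n%:R ^+ 2 * (n%:R * x * (1 - x)) = C / n%:R * (x * (1 - x)).
    by field; rewrite lt0r_neq0.
  apply: (@le_trans _ _ (C / n%:R)).
    by rewrite ler_piMr ?divr_ge0//; case/andP: xx.
  by rewrite ler_pdivrMr// mulrC -ler_pdivrMr// ltW.
have U : bern n g x <= f x + eps / 2 + C / n%:R ^+ 2 *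
    (n%:R * x * (1 - x) + (n%:R * x - n%:R * x) ^+ 2).
  rewrite -bern_quadratic; apply: bern_le => // k /gE.
  by rewrite ler_norml => /andP[_]; lra.
have L : f x - eps / 2 + (- (C / n%:R ^+ 2)) *
    (n%:R * x * (1 - x) + (n%:R * x - n%:R * x) ^+ 2) <= bern n g x.
  rewrite -bern_quadratic; apply: bern_le => // k /gE.
  by rewrite ler_norml => /andP[+ _]; lra.
by rewrite ler_norml; apply/andP; split; lra.
Qed.

Lemma muntz {R : realType} (lam : nat -> R) (f : R -> R) :
  (forall i, (1 <= i)%N -> 0 < lam i) ->
  (forall i j, (1 <= i)%N -> (1 <= j)%N -> lam i = lam j -> i = j) ->
  (fun m => \sum_(1 <= i < m.+1) lam i / (lam i ^+ 2 + 1)) @ \oo --> +oo ->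
  {within `[0, 1], continuous f} -> span_dense (muntz_fam lam) f.
Proof.
move=> lam0 lamI div; apply: span_dense_continuous => -[|j].
  by apply: span_dense_eq (span_dense_member (muntz_fam lam) 0).
apply: span_dense_eq (span_dense_powR lam j.+1%:R _ lam0 lamI div) => //.
by move=> x /andP[x0 _]; rewrite powR_mulrn.
Qed.

(** * Quantum MKZ operators *)

Section qnumbers.
Context {R : realType} (q : R).
Hypothesis q01 : 0 < q <= 1.
Let q0 : 0 < q. Proof. by case/andP: q01. Qed.

Lemma qintE k : qint q k = \sum_(j < k) q ^+ j.
Proof.
rewrite /qint; case: eqVneq => [->|q1].
  by under eq_bigr do rewrite expr1n; rewrite sumr_const card_ord.
have q1' : 1 - q != 0 by rewrite subr_eq0 eq_sym.
by apply: (mulIf q1'); rewrite mulfVK// -[LHS]opprB subrX1 -mulNr opprB mulrC.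
Qed.

Lemma qint0 : qint q 0 = 0. Proof. by rewrite qintE big_ord0. Qed.

Lemma qintS k : qint q k.+1 = 1 + q * qint q k.
Proof.
rewrite !qintE big_ord_recl expr0 mulr_sumr; congr (_ + _).
by apply: eq_bigr => i _; rewrite exprS.
Qed.

Lemma qintD n k : qint q (n + k) = qint q n + q ^+ n * qint q k.
Proof.
elim: n => [|n IH]; first by rewrite qint0 expr0 add0r mul1r.
by rewrite addSn !qintS IH exprS; ring.
Qed.

Lemma qint_ge0 k : 0 <= qint q k.
Proof. by rewrite qintE sumr_ge0// => i _; rewrite exprn_ge0// ltW. Qed.

Lemma qint_gt0 k : 0 < qint q k.+1.
Proof. by rewrite qintS ltr_pwDl// mulr_ge0 ?qint_ge0// ltW. Qed.

Lemma qint_le k n : qint q k <= qint q (k + n).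
Proof. by rewrite qintD lerDl mulr_ge0 ?qint_ge0// exprn_ge0// ltW. Qed.

Lemma qfactS k : qfact q k.+1 = qfact q k * qint q k.+1.
Proof. by rewrite /qfact big_nat_recr. Qed.

Lemma qfact_gt0 k : 0 < qfact q k.
Proof.
elim: k => [|k IH]; first by rewrite /qfact big_nil.
by rewrite qfactS mulr_gt0// qint_gt0.
Qed.

Definition mkzcoef n k : R := qbinom q (n + k) k.

Lemma mkzcoefE n k : mkzcoef n k = qfact q (n + k) / (qfact q k * qfact q n).
Proof. by rewrite /mkzcoef /qbinom addnK. Qed.

Lemma mkzcoef_gt0 n k : 0 < mkzcoef n k.
Proof. by rewrite mkzcoefE divr_gt0 ?mulr_gt0 ?qfact_gt0. Qed.

Lemma mkzcoef_n0 n : mkzcoef n 0 = 1.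
Proof.
rewrite mkzcoefE addn0 /qfact big_nil mul1r divff//.
exact: (lt0r_neq0 (qfact_gt0 n)).
Qed.

Lemma mkzcoef_0n k : mkzcoef 0 k = 1.
Proof.
rewrite mkzcoefE add0n /qfact big_nil mulr1 divff//.
exact: (lt0r_neq0 (qfact_gt0 k)).
Qed.

(** The q-Pascal rule, from splitting [[n + k + 2]] as [[n + 1] + q^(n+1) [k + 1]]. *)
Lemma mkzcoefS n k : mkzcoef n.+1 k.+1 = mkzcoef n k.+1 + q ^+ n.+1 * mkzcoef n.+1 k.
Proof.
have E : qint q (n + k).+2 = qint q n.+1 + q ^+ n.+1 * qint q k.+1.
  by rewrite -qintD addSn addnS.
rewrite !mkzcoefE !addSn !addnS !qfactS E.
have := qfact_gt0 k; have := qfact_gt0 n; have := qint_gt0 n; have := qint_gt0 k.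
by move=> ? ? ? ?; field; rewrite !lt0r_neq0.
Qed.

(** The nodes are chosen for this cancellation: weighting by the node shifts the index, so the
    operator reproduces the function [x]. *)
Lemma mkzcoef_shift n k :
  mkzcoef n k.+1 * (qint q k.+1 / qint q (k.+1 + n)) = mkzcoef n k.
Proof.
rewrite !mkzcoefE (addnC k.+1) !addnS !qfactS.
have := qfact_gt0 k; have := qfact_gt0 n; have := qint_gt0 k.
have := qint_gt0 (n + k).
by move=> ? ? ? ?; field; rewrite !lt0r_neq0.
Qed.

Definition mkznode n k : R := qint q k / qint q (k + n).

Lemma mkznode_itv n k : 0 <= mkznode n k <= 1.
Proof.
rewrite /mkznode divr_ge0 ?qint_ge0//=.
case: k => [|k]; first by rewrite qint0 mul0r.
by rewrite addSn ler_pdivrMr ?qint_gt0// mul1r -addSn qint_le.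
Qed.

(** Write [[k + 1] = 1 + q [k]]: the 1 contributes at most [1 / [n]]. In the second moment this
    undoes the index shift on the remaining node. *)
Lemma mkznodeS n k : (0 < n)%N ->
  mkznode n k.+1 <= (qint q n)^-1 + mkznode n k.
Proof.
case: n => // n _; rewrite /mkznode qintS mulrDl mul1r; apply: lerD.
  by rewrite lef_pV2 ?posrE ?qint_gt0// addnC qint_le.
rewrite addnS; apply: (@le_trans _ _ (qint q k / qint q (k.+1 + n.+1))).
  rewrite addnS ler_wpM2r ?invr_ge0 ?qint_ge0//.
  by rewrite ler_piMl ?qint_ge0//; case/andP: q01.
rewrite ler_wpM2l ?qint_ge0// lef_pV2 ?posrE ?addnS ?qint_gt0//.
by rewrite addSn -[in leRHS]addn1 qint_le.
Qed.

(** * The q-binomial series and its moments at a point of [[0, 1)] *)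

Section fixed_point.
Variable x : R.
Hypothesis x01 : 0 <= x < 1.
Let x0 : 0 <= x. Proof. by case/andP: x01. Qed.

Definition mkzsum n K := \sum_(0 <= k < K) mkzcoef n k * x ^+ k.

Lemma mkzsum_ge0 n K : 0 <= mkzsum n K.
Proof.
by rewrite sumr_ge0// => k _; rewrite mulr_ge0 ?exprn_ge0// ltW// mkzcoef_gt0.
Qed.

Lemma mkzsumS n K :
  mkzsum n.+1 K.+1 = mkzsum n K.+1 + q ^+ n.+1 * x * mkzsum n.+1 K.
Proof.
rewrite /mkzsum !big_nat_recl//= !mkzcoef_n0 -addrA; congr (_ + _).
rewrite mulr_sumr -big_split/=; apply: eq_bigr => k _.
by rewrite mkzcoefS (exprS x k); ring.
Qed.

Lemma mkzsum_nd n : nondecreasing_seq (mkzsum n).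
Proof.
apply/nondecreasing_seqP => K; rewrite /mkzsum big_nat_recr//= lerDl.
by rewrite mulr_ge0 ?exprn_ge0// ltW// mkzcoef_gt0.
Qed.

Lemma qX_x_lt1 n : 0 <= q ^+ n * x < 1.
Proof.
have /andP[_ x1] := x01; have /andP[_ q1] := q01.
apply/andP; split; first by rewrite mulr_ge0 ?exprn_ge0// ltW.
by apply: le_lt_trans x1; rewrite ler_piMl// exprn_ile1// ltW.
Qed.

Lemma mkzprod_gt0 n : 0 < \prod_(j < n) (1 - q ^+ j * x).
Proof. by apply: prodr_gt0 => j _; rewrite subr_gt0; case/andP: (qX_x_lt1 j). Qed.

(* The q-binomial series, by induction on [n] through the q-Pascal rule. *)
Lemma mkzsum_cvg n :
  mkzsum n @ \oo --> (\prod_(j < n.+1) (1 - q ^+ j * x))^-1.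
Proof.
elim: n => [|n IH].
  rewrite big_ord1 expr0 mul1r -[X in _ --> X]mul1r.
  have -> : mkzsum 0 = series (geometric 1 x).
    apply/funext => K; rewrite /mkzsum /series/=; apply: eq_bigr => k _.
    by rewrite mkzcoef_0n.
  by apply: cvg_geometric_series; rewrite ger0_norm//; case/andP: x01.
set r := q ^+ n.+1 * x; set L := (\prod_(j < n.+1) (1 - q ^+ j * x))^-1 in IH *.
have /andP[r0 r1] : 0 <= r < 1 := qX_x_lt1 n.+1.
have r1' : 0 < 1 - r by rewrite subr_gt0.
(* With [S] the partial sums at [n.+1], monotonicity and the recursion give
   [S K <= S K.+1 <= L + r S K]. *)
have bnd K : mkzsum n.+1 K <= L / (1 - r).
  rewrite ler_pdivlMr// mulrBr mulr1 lerBlDr mulrC.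
  apply: le_trans (mkzsum_nd n.+1 _ _ (leqnSn K)) _.
  rewrite mkzsumS -/r lerD2r.
  have <- : limn (mkzsum n) = L by exact/cvg_lim.
  by apply: nondecreasing_cvgn_le; [exact: mkzsum_nd|apply/cvg_ex; exists L].
have cv : cvgn (mkzsum n.+1).
  by apply: nondecreasing_is_cvgn; [exact: mkzsum_nd|exists (L / (1 - r)) => _ [K _ <-]].
set l := limn (mkzsum n.+1).
have c1 : mkzsum n.+1 K.+1 @[K --> \oo] --> l by rewrite cvg_shiftS.
have c2 : (mkzsum n K.+1 + r * mkzsum n.+1 K) @[K --> \oo] --> L + r * l.
  by apply: cvgD; [rewrite cvg_shiftS|apply: cvgMl_tmp].
have e12 : l = L + r * l.
  have E : (fun K => mkzsum n.+1 K.+1) = (fun K => mkzsum n K.+1 + r * mkzsum n.+1 K).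
    by apply/funext => K; rewrite mkzsumS.
  by rewrite E in c1; apply: (cvg_unique _ c1 c2).
have -> : (\prod_(j < n.+2) (1 - q ^+ j * x))^-1 = l.
  rewrite big_ord_recr/= -/r invfM -/L; apply: (mulIf (lt0r_neq0 r1')).
  by rewrite mulfVK ?lt0r_neq0//; lra.
exact: cv.
Qed.

(** The index shift gives the first moment exactly and the second up to [1 / [n]]. Truncation leaves
    the difference of consecutive partial sums, which vanishes in the limit. *)
Lemma mkz_second_moment n K : (0 < n)%N ->
  \sum_(0 <= k < K.+1) mkzcoef n k * x ^+ k * (mkznode n k - x) ^+ 2 <=
  (qint q n)^-1 * mkzsum n K + (mkzsum n K.+1 - mkzsum n K).
Proof.
move=> n0; have /andP[_ x1] := x01.
pose b k := mkzcoef n k * x ^+ k.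
have b0 k : 0 <= b k by rewrite mulr_ge0 ?exprn_ge0// ltW// mkzcoef_gt0.
have bS k : b k.+1 * mkznode n k.+1 = x * b k.
  by rewrite /b mulrAC mkzcoef_shift exprS; ring.
have node0 : mkznode n 0 = 0 by rewrite /mkznode qint0 mul0r.
have m1 J : \sum_(0 <= k < J.+1) b k * mkznode n k = x * mkzsum n J.
  rewrite big_nat_recl//= node0 mulr0 add0r mulr_sumr.
  by apply: eq_bigr => k _; rewrite bS.
have m2 : \sum_(0 <= k < K.+1) b k * mkznode n k ^+ 2 <=
    x * ((qint q n)^-1 * mkzsum n K + x * mkzsum n K).
  rewrite big_nat_recl//= node0 expr0n/= mulr0 add0r.
  apply: (@le_trans _ _ (x * ((qint q n)^-1 * mkzsum n K + \sum_(0 <= k < K) b k * mkznode n k))).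
    rewrite mulr_sumr -big_split/= mulr_sumr; apply: ler_sum => k _.
    rewrite expr2 mulrA bS -mulrA ler_wpM2l//.
    rewrite -/(b k) [_^-1 * _]mulrC -mulrDr ler_wpM2l//.
    exact: mkznodeS.
  rewrite ler_wpM2l// lerD2l -m1 [leRHS]big_nat_recr//= lerDl mulr_ge0//.
  by case/andP: (mkznode_itv n K).
have -> : \sum_(0 <= k < K.+1) mkzcoef n k * x ^+ k * (mkznode n k - x) ^+ 2 =
    \sum_(0 <= k < K.+1) b k * mkznode n k ^+ 2
    - 2 * x * (\sum_(0 <= k < K.+1) b k * mkznode n k) + x ^+ 2 * mkzsum n K.+1.
  rewrite /mkzsum !mulr_sumr -sumrB -big_split/=; apply: eq_bigr => k _.
  by rewrite /b; ring.
rewrite m1.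
have i0 : 0 <= (qint q n)^-1 * mkzsum n K.
  by rewrite mulr_ge0 ?invr_ge0 ?qint_ge0// mkzsum_ge0.
have dS : 0 <= mkzsum n K.+1 - mkzsum n K.
  by rewrite subr_ge0 mkzsum_nd.
have xx : x ^+ 2 <= 1 by rewrite expr_le1// ltW.
have h1 : x * ((qint q n)^-1 * mkzsum n K) <= (qint q n)^-1 * mkzsum n K.
  by rewrite ler_piMl// ltW.
have h2 : x ^+ 2 * (mkzsum n K.+1 - mkzsum n K) <= mkzsum n K.+1 - mkzsum n K.
  by rewrite ler_piMl.
by move: m2 h1 h2; rewrite mulrDr mulrA; lra.
Qed.

Lemma mkz_series_cvg n (h : R -> R) (H : R) :
  (forall t, 0 <= t <= 1 -> `|h t| <= H) ->
  cvgn (fun K => \sum_(0 <= k < K) mkzcoef n k * x ^+ k * h (mkznode n k)).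
Proof.
move=> hH.
have b0 k : 0 <= mkzcoef n k * x ^+ k.
  by rewrite mulr_ge0 ?exprn_ge0// ltW// mkzcoef_gt0.
pose u k := mkzcoef n k * x ^+ k * h (mkznode n k).
suff : cvgn [normed series u] by exact: normed_cvg.
apply: (@series_le_cvg _ _ (fun k => H * (mkzcoef n k * x ^+ k))) => [k|k|k|].
- exact: normr_ge0.
- rewrite mulr_ge0//; apply: le_trans (hH 0 _); first exact: normr_ge0.
  by rewrite lexx ler01.
- by rewrite /u/= normrM ger0_norm// mulrC ler_wpM2r// hH// mkznode_itv.
- have -> : series (fun k => H * (mkzcoef n k * x ^+ k)) = (fun K => H * mkzsum n K).
    by apply/funext => K; rewrite /series/= mulr_sumr.
  by apply: is_cvgMl_tmp; apply/cvg_ex; eexists; exact: mkzsum_cvg.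
Qed.

End fixed_point.

Lemma MKZ1 n (h : R -> R) : MKZ n q h 1 = h 1.
Proof. by rewrite /MKZ eqxx. Qed.

(** Together with [MKZ1], this interpolation at the endpoints makes the fractal equation consistent
    at interior knots. *)
Lemma MKZ0 n (h : R -> R) : MKZ n q h 0 = h 0.
Proof.
rewrite /MKZ eq_sym oner_eq0 big1 ?mul1r; last by move=> j _; rewrite mulr0 subr0.
apply: cvg_lim => //; rewrite -(cvg_shiftS _); apply: cvg_near_cst; apply: nearW => K /=.
rewrite big_nat_recl//= big1_seq ?addr0.
  by rewrite expr0 mulr1 qint0 mul0r -/(mkzcoef n 0) mkzcoef_n0 mul1r.
by move=> k _; rewrite expr0n/= mulr0 mul0r.
Qed.

Lemma MKZ_approx n (h : R -> R) (eps C : R) : (0 < n)%N -> 0 <= eps -> 0 <= C ->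
  (forall s t, 0 <= s <= 1 -> 0 <= t <= 1 -> `|h s - h t| <= eps + C * (s - t) ^+ 2) ->
  forall x, 0 <= x <= 1 -> `|MKZ n q h x - h x| <= eps + C / qint q n.
Proof.
move=> n0 e0 C0 hC x /andP[x0]; rewrite le_eqVlt => /orP[/eqP->|x1].
  by rewrite MKZ1 subrr normr0 addr_ge0// divr_ge0// qint_ge0.
have x01 : 0 <= x < 1 by rewrite x0.
have x01' : 0 <= x <= 1 by rewrite x0 ltW.
rewrite /MKZ lt_eqF//.
set P := \prod_(j < n.+1) _; have P0 : 0 < P by exact: mkzprod_gt0.
pose hs K := \sum_(0 <= k < K) mkzcoef n k * x ^+ k * h (mkznode n k).
rewrite -/(limn hs).
have hH t : 0 <= t <= 1 -> `|h t| <= `|h x| + (eps + C).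
  move=> t01; rewrite -[h t](subrK (h x)) addrC (le_trans (ler_normD _ _))// lerD2l.
  apply: le_trans (hC t x t01 x01') _; rewrite lerD2l ler_piMr//.
  rewrite -[leRHS](expr1n _ 2) -(real_normK (num_real (t - x))) lerXn2r ?nnegrE//.
  by case/andP: t01 => t0 t1; rewrite ler_norml; apply/andP; split; lra.
have hcv : cvgn hs by exact: mkz_series_cvg hH.
(* Total mass of the first [K] weights; it tends to 1, so the truncated estimate [key] passes to the
   limit. *)
pose W K := P * mkzsum x n K.
have Wcv : W @ \oo --> (1 : R).
  rewrite -[X in _ --> X](mulfV (lt0r_neq0 P0)); apply: cvgMl_tmp; exact: mkzsum_cvg.
have Wcv1 : W K.+1 @[K --> \oo] --> (1 : R) by rewrite cvg_shiftS.
have key K : `|P * hs K.+1 - h x * W K.+1| <=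
    eps * W K.+1 + C * ((qint q n)^-1 * W K + (W K.+1 - W K)).
  rewrite /W mulrCA -mulrBr normrM (gtr0_norm P0).
  have -> : eps * (P * mkzsum x n K.+1) + C * ((qint q n)^-1 * (P * mkzsum x n K)
      + (P * mkzsum x n K.+1 - P * mkzsum x n K)) =
    P * (eps * mkzsum x n K.+1 + C * ((qint q n)^-1 * mkzsum x n K
      + (mkzsum x n K.+1 - mkzsum x n K))) by ring.
  rewrite ler_wpM2l ?(ltW P0)//.
  apply: le_trans (lerD (lexx _) (ler_wpM2l C0 (mkz_second_moment x x01 n K n0))).
  rewrite /hs /mkzsum !mulr_sumr -sumrB -big_split/=.
  apply: le_trans (ler_norm_sum _ _ _) _; apply: ler_sum => k _.
  have b0 : 0 <= mkzcoef n k * x ^+ k.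
    by rewrite mulr_ge0 ?exprn_ge0// ltW// mkzcoef_gt0.
  rewrite [h x * _]mulrC -mulrBr normrM ger0_norm//.
  have -> : eps * (mkzcoef n k * x ^+ k) + C * (mkzcoef n k * x ^+ k * (mkznode n k - x) ^+ 2) =
    mkzcoef n k * x ^+ k * (eps + C * (mkznode n k - x) ^+ 2) by ring.
  by rewrite ler_wpM2l// hC// mkznode_itv.
have lcv : `|P * hs K.+1 - h x * W K.+1| @[K --> \oo] -->
    `|P * limn hs - h x * 1|.
  apply: cvg_norm; apply: cvgB; last exact: cvgMl_tmp.
  by apply: cvgMl_tmp; rewrite cvg_shiftS.
have rcv : (eps * W K.+1 + C * ((qint q n)^-1 * W K + (W K.+1 - W K)))
    @[K --> \oo] --> eps * 1 + C * ((qint q n)^-1 * 1 + (1 - 1)).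
  apply: cvgD; first exact: cvgMl_tmp.
  by apply: cvgMl_tmp; apply: cvgD; [exact: cvgMl_tmp|exact: cvgB].
rewrite !mulr1 subrr addr0 in lcv rcv.
by apply: (ler_cvg_to lcv rcv); exact: nearW key.
Qed.

End qnumbers.

(** * Fractal functions *)

Section fractal_existence.
Context {R : realType} (N : nat) (xs : nat -> R) (alpha : nat -> R -> R) (a : R).
Hypothesis N2 : (2 <= N)%N.
Hypothesis xs1 : xs 1%N = 0.
Hypothesis xsN : xs N = 1.
Hypothesis xs_incr : forall i, (1 <= i < N)%N -> xs i < xs i.+1.
Hypothesis a01 : 0 <= a < 1.
Hypothesis alpha_le : forall i t, (1 <= i <= N.-1)%N -> 0 <= t <= 1 -> `|alpha i t| <= a.

Let a0 : 0 <= a. Proof. by case/andP: a01. Qed.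
Let a1' : 0 < 1 - a. Proof. by rewrite subr_gt0; case/andP: a01. Qed.
Let iN i : (1 <= i <= N.-1)%N -> (1 <= i < N)%N.
Proof. by case/andP=> -> /leq_ltn_trans; apply; rewrite prednK// ltnW. Qed.

(** * The affine pieces and their overlaps *)

Lemma xs_le i j : (1 <= i)%N -> (i <= j)%N -> (j <= N)%N -> xs i <= xs j.
Proof.
move=> i1; elim: j => [|j IH]; first by rewrite leqn0 => /eqP i0; rewrite i0 in i1.
rewrite leq_eqVlt => /orP[/eqP<-//|]; rewrite ltnS => ij jN.
apply: le_trans (IH ij (ltnW jN)) _; apply/ltW/xs_incr.
by rewrite (leq_trans i1 ij).
Qed.

Lemma uaff_itv i t : (1 <= i <= N.-1)%N -> 0 <= t <= 1 ->
  xs i <= uaff xs i t <= xs i.+1.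
Proof.
move=> /iN/xs_incr d /andP[t0 t1]; rewrite /uaff; apply/andP; split; nra.
Qed.

Lemma uaff_inj i s t : (1 <= i <= N.-1)%N -> uaff xs i s = uaff xs i t -> s = t.
Proof.
move=> /iN/xs_incr d /addIr; apply: mulfI.
by rewrite subr_eq0 gt_eqF.
Qed.

(** The knot inequality [xs i.+1 <= xs j] separates the two images, so they can meet only at a
    common knot. *)
Lemma uaff_lt i j s t : (1 <= i)%N -> (i < j)%N -> (j <= N.-1)%N ->
  0 <= s <= 1 -> 0 <= t <= 1 ->
  uaff xs i s = uaff xs j t -> s = 1 /\ t = 0.
Proof.
move=> i1 ij jN s01 t01 E.
have ib : (1 <= i <= N.-1)%N by rewrite i1 (leq_trans (ltnW ij) jN).
have jb : (1 <= j <= N.-1)%N by rewrite jN (leq_trans i1 (ltnW ij)).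
have /andP[_ u1] := uaff_itv i s ib s01; have /andP[u2 _] := uaff_itv j t jb t01.
have /andP[_ jN'] := iN _ jb.
have x12 := xs_le i.+1 j isT ij (ltnW jN').
split; [apply: (uaff_inj i _ _ ib)|apply: (uaff_inj j _ _ jb)].
  by rewrite [RHS]/uaff mulr1 subrK; apply/eqP; rewrite eq_le u1/= (le_trans x12)// E.
by rewrite [RHS]/uaff mulr0 add0r; apply/eqP; rewrite eq_le u2 andbT -E (le_trans u1).
Qed.

Lemma uaff_surj y : 0 <= y <= 1 ->
  exists p : nat * R, [/\ (1 <= p.1 <= N.-1)%N, 0 <= p.2 <= 1 & uaff xs p.1 p.2 = y].
Proof.
move=> /andP[y0 y1]; have yN : y <= xs N by rewrite xsN.
have H m : (m.+2 <= N)%N -> y <= xs m.+2 ->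
    exists2 i, (1 <= i <= N.-1)%N & xs i <= y <= xs i.+1.
  elim: m => [|m IH] mN ym; first by exists 1%N; rewrite ?xs1 ?y0//= -ltnS prednK// ltnW.
  have [ym'|ym'] := leP y (xs m.+2); first exact: IH (ltnW mN) ym'.
  exists m.+2; last by rewrite ym ltW.
  by rewrite /= -ltnS prednK// ltnW.
have NE : N = N.-2.+2 by case: N N2 => [|[]].
have [i iN' /andP[yi yi']] : exists2 i, (1 <= i <= N.-1)%N & xs i <= y <= xs i.+1.
  by apply: (H N.-2); rewrite -NE.
have d : 0 < xs i.+1 - xs i by rewrite subr_gt0 xs_incr// iN.
exists (i, (y - xs i) / (xs i.+1 - xs i)); split => //=.
  apply/andP; split; first by rewrite divr_ge0 ?subr_ge0// ltW// -subr_gt0.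
  by rewrite ler_pdivrMr// mul1r lerD2r.
by rewrite /uaff mulrC mulfVK ?subrK// gt_eqF.
Qed.

Lemma uaff_end i t : (1 <= i <= N.-1)%N -> 0 <= t <= 1 ->
  uaff xs i t = 0 \/ uaff xs i t = 1 -> t = 0 \/ t = 1.
Proof.
move=> ib t01; have /andP[i1 iN'] := iN _ ib.
have l := xs_le 1 i isT i1 (ltnW iN'); have r := xs_le i.+1 N isT iN' (leqnn N).
have := xs_incr i (iN _ ib); move: l r; rewrite xs1 xsN /uaff.
move: t01 => /andP[t0 t1] l r d [E|E]; [left|right].
  apply/eqP; rewrite eq_le t0 andbT leNgt; apply/negP => t0'.
  have : 0 < (xs i.+1 - xs i) * t by rewrite mulr_gt0// subr_gt0.
  lra.
apply/eqP; rewrite eq_le t1/= leNgt; apply/negP => t0'.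
have : 0 < (xs i.+1 - xs i) * (1 - t) by rewrite mulr_gt0// subr_gt0.
lra.
Qed.

(** * Solving the fractal equation by iteration *)

(** Picard iterates for the unknown [D = G - h]: [tau] selects a preimage under some [u_i], [beta]
    is the matching value of [alpha], and [e = h - M h]. *)
Fixpoint fractal_iter (tau beta e : R -> R) (k : nat) (y : R) : R :=
  if k is k'.+1 then beta y * (fractal_iter tau beta e k' (tau y) + e (tau y)) else 0.

Lemma fractal_iter_diff (tau beta e : R -> R) (d : R) :
  (forall y, 0 <= y <= 1 -> 0 <= tau y <= 1) ->
  (forall y, 0 <= y <= 1 -> `|beta y| <= a) ->
  (forall y, 0 <= y <= 1 -> `|e y| <= d) ->
  forall k y, 0 <= y <= 1 ->
    `|fractal_iter tau beta e k.+1 y - fractal_iter tau beta e k y| <= d * a ^+ k.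
Proof.
move=> tauI betaI eI; have d0 : 0 <= d.
  by apply: le_trans (eI 0 _) => //; rewrite lexx ler01.
elim=> [|k IH] y y01.
  rewrite /= add0r subr0 expr0 mulr1 normrM -[leRHS]mul1r.
  apply: ler_pM => //; last exact/eI/tauI.
  by apply: le_trans (betaI _ y01) _; apply: ltW; case/andP: a01.
rewrite -[fractal_iter _ _ _ k.+2 y]/(beta y * (fractal_iter tau beta e k.+1 (tau y) + e (tau y))).
rewrite -[fractal_iter _ _ _ k.+1 y]/(beta y * (fractal_iter tau beta e k (tau y) + e (tau y))).
rewrite -mulrBr normrM exprS mulrCA; apply: ler_pM => //; first exact: betaI.
by rewrite opprD addrACA subrr addr0; apply/IH/tauI.
Qed.

Lemma fractal_iter_le (tau beta e : R -> R) (d : R) :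
  (forall y, 0 <= y <= 1 -> 0 <= tau y <= 1) ->
  (forall y, 0 <= y <= 1 -> `|beta y| <= a) ->
  (forall y, 0 <= y <= 1 -> `|e y| <= d) ->
  forall k y, 0 <= y <= 1 -> `|fractal_iter tau beta e k y| <= d / (1 - a).
Proof.
move=> tauI betaI eI; have d0 : 0 <= d.
  by apply: le_trans (eI 0 _) => //; rewrite lexx ler01.
elim=> [|k IH] y y01; first by rewrite normr0 divr_ge0// ltW.
rewrite /= normrM.
apply: (@le_trans _ _ (a * (d / (1 - a) + d))).
  apply: ler_pM => //; first exact: betaI.
  by apply: le_trans (ler_normD _ _) _; rewrite lerD ?IH ?eI ?tauI.
(* The bound is preserved because [a (2 - a) = 1 - (1 - a)^2 <= 1]. *)
have -> : a * (d / (1 - a) + d) = d / (1 - a) * (a * (2 - a)).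
  by field; rewrite gt_eqF.
rewrite ler_piMr ?divr_ge0 ?(ltW a1')//.
by have := sqr_ge0 (1 - a); lra.
Qed.

Lemma fractal_iter_cvg (tau beta e : R -> R) (d : R) :
  (forall y, 0 <= y <= 1 -> 0 <= tau y <= 1) ->
  (forall y, 0 <= y <= 1 -> `|beta y| <= a) ->
  (forall y, 0 <= y <= 1 -> `|e y| <= d) ->
  forall y, 0 <= y <= 1 -> cvgn (fun k => fractal_iter tau beta e k y).
Proof.
move=> tauI betaI eI y y01; have d0 : 0 <= d.
  by apply: le_trans (eI 0 _) => //; rewrite lexx ler01.
pose u k := fractal_iter tau beta e k y.
have E : u = series (fun k => u k.+1 - u k).
  apply/funext => k; rewrite /series/= telescope_sumr//.
  by rewrite /u /= subr0.
rewrite -/u E; apply: normed_cvg.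
apply: (@series_le_cvg _ _ (geometric d a)) => [k|k|k|].
- exact: normr_ge0.
- by rewrite /= mulr_ge0// exprn_ge0.
- exact: fractal_iter_diff.
- by apply: is_cvg_geometric_series; rewrite ger0_norm//; case/andP: a01.
Qed.

(** Choosing one address [(i, t)] for every [y] turns the system into a single equation, solved by
    the limit [D] of the iterates; it remains to treat knots, which have two addresses. *)
Lemma is_fractal_exists n q (h : R -> R) (d H : R) :
  (forall t, 0 <= t <= 1 -> `|h t - MKZ n q h t| <= d) ->
  (forall t, 0 <= t <= 1 -> `|h t| <= H) ->
  h 0 = MKZ n q h 0 -> h 1 = MKZ n q h 1 ->
  exists G, is_fractal N xs alpha n q h G.
Proof.
move=> hd hH h0 h1.
have /choice[p pP] : forall y : R, exists r : nat * R, 0 <= y <= 1 ->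
    [/\ (1 <= r.1 <= N.-1)%N, 0 <= r.2 <= 1 & uaff xs r.1 r.2 = y].
  move=> y; have [/uaff_surj[r rP]|ny] := pselect (0 <= y <= 1); first by exists r.
  by exists (0%N, 0).
pose tau y := (p y).2; pose beta y := alpha (p y).1 (p y).2.
pose e t := h t - MKZ n q h t.
have tauI y : 0 <= y <= 1 -> 0 <= tau y <= 1 by move=> /pP[].
have betaI y : 0 <= y <= 1 -> `|beta y| <= a by move=> /pP[? ? _]; exact: alpha_le.
pose D y := limn (fun k => fractal_iter tau beta e k y).
have Dcv y : 0 <= y <= 1 -> fractal_iter tau beta e k y @[k --> \oo] --> D y.
  by move=> y01; apply: (fractal_iter_cvg tau beta e d).
have DE y : 0 <= y <= 1 -> D y = beta y * (D (tau y) + e (tau y)).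
  move=> y01; have c1 : fractal_iter tau beta e k.+1 y @[k --> \oo] --> D y.
    by rewrite (cvg_shiftS (fun k => fractal_iter tau beta e k y)); exact: Dcv.
  apply: (cvg_unique _ c1) => //=.
  apply: cvgMl_tmp; apply: cvgD; last exact: cvg_cst.
  exact/Dcv/tauI.
(* [tau] sends endpoints to endpoints by [uaff_end], and [e] vanishes there, so every iterate is
   0. *)
have De y : y = 0 \/ y = 1 -> D y + e y = 0.
  move=> y01; have -> : e y = 0 by case: y01 => ->; rewrite /e ?h0 ?h1 subrr.
  rewrite addr0; apply: cvg_lim => //; apply: cvg_near_cst; apply: nearW => k.
  elim: k y y01 => //= k IH y yZ.
  have y01 : 0 <= y <= 1 by case: yZ => ->; rewrite ?lexx ler01.
  have tZ : tau y = 0 \/ tau y = 1.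
    by have [ib t01 E] := pP y y01; apply: (uaff_end _ _ ib t01); rewrite E.
  rewrite IH//; case: tZ => ->; by rewrite /e ?h0 ?h1 subrr addr0 mulr0.
(* An interior knot is both [u_i 1] and [u_j 0]; the two equations there agree
   because [D] and [h - M h] vanish at 0 and 1. *)
exists (fun y => h y + D y); split.
  exists (H + d / (1 - a)) => t t01; apply: le_trans (ler_normD _ _) _.
  rewrite lerD ?hH//.
  have c : `|fractal_iter tau beta e k t| @[k --> \oo] --> `|D t|.
    by apply: cvg_norm; exact: Dcv.
  have c' : (fun=> d / (1 - a)) @ \oo --> d / (1 - a) by exact: cvg_cst.
  apply: (ler_cvg_to c c'); apply: nearW => k.
  exact: fractal_iter_le.
move=> i t ib t01.
have y01 : 0 <= uaff xs i t <= 1.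
  have /andP[l r] := uaff_itv i t ib t01; have /andP[i1 iN'] := iN _ ib.
  rewrite -[X in X <= _]xs1 -[X in _ <= _ <= X]xsN.
  by rewrite (le_trans _ l) ?(le_trans r)// xs_le// ltnW.
rewrite DE//; congr (_ + _).
have -> : h t + D t - MKZ n q h t = D t + e t by rewrite /e; ring.
have [jb s01 E] := pP _ y01; rewrite /tau /beta.
move: (p _).1 (p _).2 jb s01 E => j s jb s01 E.
have /andP[i1 iN'] := ib; have /andP[j1 jN'] := jb.
have [ij|ij|ij] := ltngtP i j.
- have [t1 s0] := uaff_lt i j t s i1 ij jN' t01 s01 (esym E).
  by rewrite (De s (or_introl s0)) (De t (or_intror t1)) !mulr0.
- have [s1 t0] := uaff_lt j i s t j1 ij iN' s01 t01 E.
  by rewrite (De s (or_intror s1)) (De t (or_introl t0)) !mulr0.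
- by move: E; rewrite -ij => /(uaff_inj i _ _ ib) ->.
Qed.

(** Applying the equation [k] times shrinks the crude bound [C + H] by [a^k] while the accumulated
    error stays below [d / (1 - a)]; then [k] tends to infinity. *)
Lemma is_fractal_close n q (h G : R -> R) (d H : R) :
  is_fractal N xs alpha n q h G ->
  (forall t, 0 <= t <= 1 -> `|h t| <= H) ->
  (forall t, 0 <= t <= 1 -> `|h t - MKZ n q h t| <= d) ->
  forall y, 0 <= y <= 1 -> `|G y - h y| <= d / (1 - a).
Proof.
move=> [[C GC] GE] hH hd.
have d0 : 0 <= d by apply: le_trans (hd 0 _) => //; rewrite lexx ler01.
have B k y : 0 <= y <= 1 -> `|G y - h y| <= (C + H) * a ^+ k + d / (1 - a).
  elim: k y => [|k IH] y y01.
    rewrite expr0 mulr1 ler_wpDr ?divr_ge0 ?(ltW a1')//.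
    by apply: le_trans (ler_normB _ _) _; rewrite lerD ?GC ?hH.
  have [[i t]/= [ib t01 <-]] := uaff_surj y y01.
  rewrite GE// addrC addKr normrM.
  apply: (@le_trans _ _ (a * ((C + H) * a ^+ k + d / (1 - a) + d))).
    apply: ler_pM => //; first exact: alpha_le.
    have -> : G t - MKZ n q h t = (G t - h t) + (h t - MKZ n q h t) by ring.
    by apply: le_trans (ler_normD _ _) _; rewrite lerD ?IH ?hd.
  rewrite -[_ + d]addrA mulrDr exprS mulrCA lerD2l.
  have -> : a * (d / (1 - a) + d) = d / (1 - a) * (a * (2 - a)).
    by field; rewrite gt_eqF.
  rewrite ler_piMr ?divr_ge0 ?(ltW a1')//.
  by have := sqr_ge0 (1 - a); lra.
move=> y y01.
have cv : (C + H) * a ^+ k + d / (1 - a) @[k --> \oo] --> 0 + d / (1 - a).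
  apply: cvgD; last exact: cvg_cst.
  by apply: cvg_geometric; rewrite ger0_norm//; case/andP: a01.
have c' : (fun=> `|G y - h y|) @ \oo --> `|G y - h y| by exact: cvg_cst.
rewrite -[leRHS]add0r; apply: (ler_cvg_to c' cv); apply: nearW => k.
exact: B.
Qed.

(** Existence makes [xget] return a solution, and the previous bound holds for every solution. *)
Lemma fractal_close n q (h : R -> R) (d H : R) :
  (forall t, 0 <= t <= 1 -> `|h t| <= H) ->
  (forall t, 0 <= t <= 1 -> `|h t - MKZ n q h t| <= d) ->
  h 0 = MKZ n q h 0 -> h 1 = MKZ n q h 1 ->
  forall y, 0 <= y <= 1 -> `|fractal N xs alpha n q h y - h y| <= d / (1 - a).
Proof.
move=> hH hd h0 h1; apply: (is_fractal_close n q h _ d H) => //.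
rewrite /fractal; apply: xgetPex.
exact: is_fractal_exists hd hH h0 h1.
Qed.

End fractal_existence.

(** * Uniform constants and the density theorem *)

Lemma uniform_contraction {R : realType} (alpha : nat -> R -> R) (M : nat) :
  (forall i, (1 <= i <= M)%N ->
     exists c : R, c < 1 /\ forall t, 0 <= t <= 1 -> `|alpha i t| <= c) ->
  exists2 a : R, 0 <= a < 1 &
    forall i t, (1 <= i <= M)%N -> 0 <= t <= 1 -> `|alpha i t| <= a.
Proof.
elim: M => [|M IH] H.
  by exists 0; rewrite ?lexx ?ltr01// => -[|i] t.
have [|a /andP[a0 a1] aP] := IH; first by move=> i /andP[i1 iM]; apply: H; rewrite i1 leqW.
have [|c [c1 cP]] := H M.+1; first by rewrite leqnn.
exists (Num.max a c); first by rewrite le_max a0/= gt_max a1.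
move=> i t /andP[i1]; rewrite leq_eqVlt => /orP[/eqP->|iM] t01.
  by rewrite le_max cP// orbT.
by rewrite le_max aP// i1.
Qed.

Lemma within_continuous_powR {R : realType} (p : R) : 0 < p ->
  {within `[0, 1], continuous (fun t : R => t `^ p)}.
Proof.
move=> p0; have cpos (t : R) : 0 < t -> {for t, continuous (fun t : R => t `^ p)}.
  move=> t0; apply/differentiable_continuous/derivable1_diffP.
  by apply: derivable_powR; rewrite in_itv/= t0.
apply/continuous_within_itvP => //; split.
- by move=> t; rewrite in_itv/= => /andP[t0 _]; exact: cpos.
- by rewrite powR0 ?lt0r_neq0//; exact: powR_cvg0.
- exact/cvg_at_left_filter/(cpos 1 ltr01).
Qed.

(** Fix [M > 2 A]. For large [n] the first [M] terms of [[n]] are at least [q_n^M >= 1 / 2], which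
    already sum to [M / 2]. *)
Lemma qint_unbounded {R : realType} (q : nat -> R) :
  (forall n, (1 <= n)%N -> 0 < q n <= 1) -> q @ \oo --> (1 : R) ->
  forall A : R, exists2 n, (1 <= n)%N & A <= qint (q n) n.
Proof.
move=> q01 q1 A; pose M := (Num.truncn (2 * A)).+1.
have MA : 2 * A < M%:R by exact: truncnS_gt.
have cM : q n ^+ M @[n --> \oo] --> (1 : R).
  rewrite -[X in _ --> X](expr1n _ M).
  exact: (@continuous_cvg _ _ _ _ _ q (fun x : R => x ^+ M) 1
    (@exprn_continuous R M 1) q1).
have h : (1 / 2 : R) < 1 by lra.
have [K _ KP] : \forall n \near \oo, 1 / 2 <= q n ^+ M.
  exact: (cvgr_ge _ cM _ h).
pose n := (maxn K M).+1; have n1 : (1 <= n)%N by [].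
exists n => //; have /andP[q0 ql] := q01 n n1.
have nM : (M <= n)%N by rewrite leqW// leq_maxr.
apply: (@le_trans _ _ (qint (q n) M)); last first.
  by have := qint_le (q n) (q01 n n1) M (n - M); rewrite subnKC.
rewrite qintE; apply: (@le_trans _ _ (\sum_(j < M) (1 / 2 : R))).
  by rewrite sumr_const card_ord -mulr_natr; lra.
apply: ler_sum => j _; apply: le_trans (KP n _) _.
  by rewrite /= leqW// leq_maxl.
by rewrite ler_wiXn2l ?(ltW q0)// ltnW.
Qed.

Theorem theorem5p1 (R : realType) (N : nat) (xs : nat -> R)
  (q : nat -> R) (alpha : nat -> R -> R) (lam : nat -> R) :
  (2 <= N)%N ->
  xs 1%N = 0 -> xs N = 1 ->
  (forall i, (1 <= i < N)%N -> xs i < xs i.+1) ->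
  (forall n, (1 <= n)%N -> 0 < q n <= 1) ->
  q @ \oo --> (1 : R) ->
  (forall i, (1 <= i <= N.-1)%N ->
     exists c : R, c < 1 /\ forall t, 0 <= t <= 1 -> `|alpha i t| <= c) ->
  (forall i, (1 <= i)%N -> 0 < lam i) ->
  (forall i j, (1 <= i)%N -> (1 <= j)%N -> lam i = lam j -> i = j) ->
  (fun m => \sum_(1 <= i < m.+1) lam i / (lam i ^+ 2 + 1)) @ \oo --> +oo ->
  forall f : R -> R, {within `[0, 1], continuous f} ->
  forall eps : R, 0 < eps ->
  exists n m : nat, [/\ (1 <= n)%N, (1 <= m)%N &
    exists c : nat -> R, forall x : R, 0 <= x <= 1 ->
      `|f x - (c 0%N + \sum_(1 <= i < m.+1)
           c i * fractal N xs alpha n (q n) (fun t => t `^ lam i) x)| < eps].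
Proof.
move=> N2 xs1 xsN xs_incr q01 q1 alphaP lam0 lamI div f cf eps e0.
have [a a01 aP] := uniform_contraction alpha N.-1 alphaP.
have a1 : 0 < 1 - a by rewrite subr_gt0; case/andP: a01.
have e20 : 0 < eps / 2 by rewrite divr_gt0.
have [m [c Hc]] := muntz lam f lam0 lamI div cf _ e20.
pose b i := if (i < m)%N then c i else 0.
pose A := \sum_(1 <= i < m.+2) `|b i| + 1.
have A0 : 0 < A by rewrite ltr_wpDl// sumr_ge0.
(* A fractal error [d / (1 - a) = eps / (4 A)] per power, weighted by the [|b i|], totals at most
   [eps / 4]; half of [d] is for the modulus of continuity and half for [C i / [n]]. *)
pose d := eps / 4 / A * (1 - a).
have d0 : 0 < d by rewrite !mulr_gt0// invr_gt0.
have d20 : 0 < d / 2 by rewrite divr_gt0.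
have /choice[C CP] : forall i, exists C : R, (1 <= i)%N -> 0 <= C /\
    forall x y, 0 <= x <= 1 -> 0 <= y <= 1 ->
      `|x `^ lam i - y `^ lam i| <= d / 2 + C * (x - y) ^+ 2.
  move=> [|i]; first by exists 0.
  have [C C0 CP] := within_continuous_quadratic _
    (within_continuous_powR (lam i.+1) (lam0 i.+1 isT)) _ d20.
  by exists C.
(* [B] dominates each [C i], so that one [n] serves all the exponents. *)
pose B := \sum_(1 <= i < m.+2) C i.
have [n n1 nB] := qint_unbounded q q01 q1 (B / (d / 2)).
have n0 : 0 < qint (q n) n by case: n n1 nB => // n n1 _; exact/qint_gt0/q01.
(* The Müntz sum may be empty, so it is padded with zero coefficients to reach a positive length. *)
exists n, m.+1; split => //; exists b => x x01.
have fr i : (1 <= i < m.+2)%N ->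
    `|fractal N xs alpha n (q n) (fun t => t `^ lam i) x - x `^ lam i| <= eps / 4 / A.
  move=> im; have /andP[i1 _] := im; have [C0 CiP] := CP i i1.
  have -> : eps / 4 / A = d / (1 - a) by rewrite /d mulfK// gt_eqF.
  apply: (fractal_close N xs alpha a N2 xs1 xsN xs_incr a01 aP n (q n) _ d 1) => //.
  - move=> t /andP[t0 t1]; rewrite ger0_norm ?powR_ge0//.
    apply: (@le_trans _ _ (1 `^ lam i)); last by rewrite powR1.
    by rewrite ge0_ler_powR ?nnegrE// ltW// lam0.
  - move=> t t01; rewrite distrC.
    apply: le_trans (MKZ_approx (q n) (q01 n n1) n _ _ _ n1 (ltW d20) C0 CiP t t01) _.
    rewrite [leRHS](splitr d) lerD2l ler_pdivrMr// mulrC -ler_pdivrMr//.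
    apply: le_trans nB; rewrite ler_wpM2r ?invr_ge0 ?(ltW d20)//.
    rewrite /B (bigD1_seq i) ?mem_index_iota ?iota_uniq//= lerDl.
    rewrite big_seq_cond sumr_ge0// => j /andP[]; rewrite mem_index_iota => /andP[j1 _] _.
    by case: (CP j j1).
  - by rewrite MKZ0// q01.
  - by rewrite MKZ1.
have E : \sum_(i < m) c i * muntz_fam lam i x =
    b 0%N + \sum_(1 <= i < m.+2) b i * x `^ lam i.
  rewrite (@sum_widen _ _ _ m m.+2)//; last by rewrite leqW.
  rewrite big_ord_recl/= mulr1; congr (_ + _).
  by rewrite big_add1/= big_mkord.
have := Hc x x01; rewrite E => {}Hc.
have S : `|\sum_(1 <= i < m.+2) b i * fractal N xs alpha n (q n) (fun t => t `^ lam i) x -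
    \sum_(1 <= i < m.+2) b i * x `^ lam i| <= eps / 4.
  rewrite -sumrB; apply: le_trans (ler_norm_sum _ _ _) _.
  apply: (@le_trans _ _ (\sum_(1 <= i < m.+2) `|b i| * (eps / 4 / A))).
    rewrite big_seq [leRHS]big_seq; apply: ler_sum => i; rewrite mem_index_iota => im.
    by rewrite -mulrBr normrM ler_wpM2l// fr.
  rewrite -mulr_suml mulrA ler_pdivrMr// mulrC.
  by apply: ler_wpM2l; [rewrite divr_ge0// ltW|rewrite /A lerDl].
move: Hc S; set X := \sum_(_ <= _ < _) _; set Y := \sum_(_ <= _ < _) _ => Hc S.
rewrite -/Y in Hc.
have -> : f x - (b 0%N + Y) = f x - (b 0%N + X) - (Y - X) by ring.
apply: le_lt_trans (ler_normB _ _) _.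
by apply: le_lt_trans (lerD Hc S) _; lra.
Qed.
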